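(* For every $c\ge2$, $$U_{N,c}^2=T_{N,c}^{\mathrm{W}}-\frac{1}{12N}.$$
   Context: Setting. For $\ell=1,\ldots,c$, the $\ell$th sample consists of angles $\Theta_1^{(\ell)},\ldots,\Theta_{n_\ell}^{(\ell)}\in[0,2\pi)$ with $n_\ell\ge2$, and $N:=\sum_{\ell=1}^c n_\ell$; observations are mutually independent with absolutely continuous distributions (so there are no ties, almost surely). Multisample Watson statistic. $\widehat F_{\ell,n_\ell}$ is the empirical cdf on $[0,2\pi)$ (started at $0$) of the $\ell$th sample and $\widehat H_N:=\sum_{\ell=1}^c\frac{n_\ell}{N}\widehat F_{\ell,n_\ell}$ is the empirical cdf of the pooled sample. Then $$U^2_{N,c}:=\sum_{\ell=1}^{c}n_\ell\int_0^{2\pi}\Big[\widehat F_{\ell,n_\ell}(x)-\widehat H_N(x)-\int_0^{2\pi}\big(\widehat F_{\ell,n_\ell}(y)-\widehat H_N(y)\big)\,\mathrm{d}\widehat H_N(y)\Big]^2\,\mathrm{d}\widehat H_N(x).$$ Uniform-scores Watson statistic. $r_i^{(\ell)}\in\{1,\ldots,N\}$ is the rank of $\Theta_i^{(\ell)}$ in the pooled sample and $c_i^{(\ell)}:=2\pi r_i^{(\ell)}/N$. The Watson kernel is $\phi^{\mathrm{W}}(x):=\frac1{12}+\frac{\theta_x}{4\pi}\big(\frac{\theta_x}{2\pi}-1\big)$ for $x\in[-1,1]$, where $\theta_x:=\arccos(x)\in[0,\pi]$, and $$T_{N,c}^{\mathrm{W}}:=\sum_{\ell=1}^c\frac1{n_\ell}\sum_{i,j=1}^{n_\ell}\phi^{\mathrm{W}}\big(\cos(c_i^{(\ell)}-c_j^{(\ell)})\big).$$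 *)

(* Defs.v *)
From HB Require Import structures.
From mathcomp Require Import all_boot all_order all_algebra.
From mathcomp Require Import all_classical all_reals all_analysis.

Set Implicit Arguments.
Unset Strict Implicit.
Unset Printing Implicit Defensive.

Import Order.TTheory GRing.Theory Num.Theory.
Import numFieldNormedType.Exports.

Local Open Scope classical_set_scope.
Local Open Scope ring_scope.

Definition mutually_independent (R : realType) (d : measure_display)
    (Omega : measurableType d) (P : probability Omega R) (I : finType)
    (X : I -> {RV P >-> R}) : Prop :=
  forall (J : {set I}) (A : I -> set R), (forall i, measurable (A i)) ->
    P (\bigcap_(i in [set` J]) (X i @^-1` A i)) =
    (\prod_(i in J) P (X i @^-1` A i))%E.

(* A realization of the [c] samples is a family
   [theta : forall l : 'I_c, 'I_(n l) -> R]; the pooled sample is indexed by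
   the pairs [p : {l : 'I_c & 'I_(n l)}]. *)

Definition total_size (c : nat) (n : 'I_c -> nat) : nat :=
  (\sum_(l < c) n l)%N.

(* A function on the whole line: for data in [0, 2 pi) it vanishes on the
   negative reals, so its Stieltjes measure charges an observation at 0. *)
Definition ecdf (R : realType) (m : nat) (x : 'I_m -> R) (t : R) : R :=
  #|[pred i : 'I_m | x i <= t]|%:R / m%:R.

Definition pooled_ecdf (R : realType) (c : nat) (n : 'I_c -> nat)
    (theta : forall l, 'I_(n l) -> R) (t : R) : R :=
  \sum_(l < c) (n l)%:R / (total_size n)%:R * ecdf (theta l) t.

Lemma ecdf_nondecreasing (R : realType) (m : nat) (x : 'I_m -> R) :
  nondecreasing (ecdf x).
Proof.
move=> s t st; rewrite /ecdf ler_wpM2r// ler_nat.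
by apply/subset_leq_card/fintype.subsetP => i; rewrite !inE => /le_trans; apply.
Qed.

Lemma near_right_ecdf (R : realType) (m : nat) (x : 'I_m -> R) (t : R) :
  \forall s \near t^'+, ecdf x s = ecdf x t.
Proof.
have xE (i : 'I_m) : \forall s \near t^'+, (x i <= s) = (x i <= t).
  have [xt|tx] := leP (x i) t.
    near=> s; apply: (le_trans xt); apply: ltW; near: s.
    exact: nbhs_right_gt.
  near=> s; apply/negbTE; rewrite -ltNge; near: s.
  exact: nbhs_right_lt.
have : \forall s \near t^'+, forall i, (x i <= s) = (x i <= t).
  by apply: filter_forall.
apply: filterS => s xs.
by rewrite /ecdf; congr (_%:R / _); apply: eq_card => i; rewrite !inE.
Unshelve. all: by end_near. Qed.

Lemma pooled_ecdf_nondecreasing (R : realType) (c : nat) (n : 'I_c -> nat)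
  (theta : forall l, 'I_(n l) -> R) : nondecreasing (pooled_ecdf theta).
Proof.
move=> s t st; apply: ler_sum => l _.
by rewrite ler_wpM2l ?divr_ge0//; exact: ecdf_nondecreasing.
Qed.

Lemma pooled_ecdf_right_continuous (R : realType) (c : nat) (n : 'I_c -> nat)
  (theta : forall l, 'I_(n l) -> R) : right_continuous (pooled_ecdf theta).
Proof.
move=> t; apply: cvg_near_cst.
have : \forall s \near t^'+, forall l, ecdf (theta l) s = ecdf (theta l) t.
  by apply: filter_forall => l; exact: near_right_ecdf.
by apply: filterS => s ths; apply: eq_bigr => l _; rewrite ths.
Qed.

HB.instance Definition _ (R : realType) (c : nat) (n : 'I_c -> nat)
    (theta : forall l, 'I_(n l) -> R) :=
  isCumulative.Build R _ R (pooled_ecdf theta)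
    (@pooled_ecdf_nondecreasing R c n theta)
    (@pooled_ecdf_right_continuous R c n theta).

Definition pooled_integral (R : realType) (c : nat) (n : 'I_c -> nat)
    (theta : forall l, 'I_(n l) -> R) (f : R -> R) : R :=
  \int[lebesgue_stieltjes_measure (pooled_ecdf theta)]_(x in `[0, 2 * pi[) f x.

Definition watson_U2 (R : realType) (c : nat) (n : 'I_c -> nat)
    (theta : forall l, 'I_(n l) -> R) : R :=
  \sum_(l < c) (n l)%:R *
    pooled_integral theta (fun x =>
      (ecdf (theta l) x - pooled_ecdf theta x
       - pooled_integral theta (fun y =>
           ecdf (theta l) y - pooled_ecdf theta y)) ^+ 2).

Definition pooled_rank (R : realType) (c : nat) (n : 'I_c -> nat)
    (theta : forall l, 'I_(n l) -> R) (l : 'I_c) (i : 'I_(n l)) : nat :=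
  #|[pred p : {k : 'I_c & 'I_(n k)} |
      theta (tag p) (tagged p) <= theta l i]|.

Definition uniform_score (R : realType) (c : nat) (n : 'I_c -> nat)
    (theta : forall l, 'I_(n l) -> R) (l : 'I_c) (i : 'I_(n l)) : R :=
  2 * pi * (pooled_rank theta i)%:R / (total_size n)%:R.

Definition watson_kernel (R : realType) (x : R) : R :=
  12^-1 + acos x / (4 * pi) * (acos x / (2 * pi) - 1).

Definition watson_T (R : realType) (c : nat) (n : 'I_c -> nat)
    (theta : forall l, 'I_(n l) -> R) : R :=
  \sum_(l < c) (n l)%:R^-1 *
    \sum_(i < n l) \sum_(j < n l)
      watson_kernel (cos (uniform_score theta i - uniform_score theta j)).

(* Main.v *)
Require Import Defs.
From mathcomp Require Import all_boot all_order all_algebra.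
From mathcomp Require Import all_classical all_reals all_analysis.
From mathcomp Require Import ring lra zify measurable_realfun.

Import Order.TTheory GRing.Theory Num.Theory.
Import numFieldNormedType.Exports.

Local Open Scope classical_set_scope.
Local Open Scope ring_scope.

(** Both statistics depend on the data through the pooled ranks only, and the
    identity already holds term by term over the pairs of observations of each
    sample.

    Almost surely there are no ties ([ae_no_ties]): two independent variables
    whose laws have no atoms differ almost surely, since their joint law is a
    product and the diagonal has null sections. Without ties the pooled ranks
    are a bijection onto [1, ..., N] ([sum_over_ranks]), and integrating against
    the pooled empirical cdf is averaging over the pooled sample
    ([pooled_integralE]); hence every integral becomes an average over the
    ranks [k = 1, ..., N].

    At the observation of rank [k], the difference between the [l]th empirical
    cdf and the pooled one is the average, over the members of sample [l], of
    the functions [k |-> 1(a <= k) - k / N], where [a] is the rank of the member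
    ([ecdf_subr_pooled_rank]). Expanding the centred square, [n_l] times the
    integral is [1 / n_l] times the sum over pairs of members of the covariances
    of these functions under the uniform law on the ranks. For ranks [a] and
    [b], with [d = |a - b| / N], the covariance is
    [1/12 - d (1 - d) / 2 - 1 / (12 N^2)] ([cov_step_ramp]).

    The first two terms are the Watson kernel at the cosine of the difference
    of the uniform scores ([watson_kernel_score]): on the circle the arc
    distance replaces [d] by [min (d, 1 - d)], which [d (1 - d)] does not see.
    The remaining constants add up to
    [sum_l (1 / n_l) n_l^2 / (12 N^2) = 1 / (12 N)]. *)

(** * Covariances of steps under the uniform law on ranks *)

(** The right-hand side telescopes: [Q] is a discrete primitive of the product,
    built from the primitives [k (k - 1) / 2] of [k] and
    [k (k - 1) (2 k - 1) / 6] of [k^2]. *)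
Lemma sum_quadratic {F : numFieldType} (s t s' t' : F) (a b : nat) :
  (a <= b)%N ->
  let Q (x : F) := s * s' * x + (s * t' + s' * t) * (x * (x - 1) / 2)
    + t * t' * (x * (x - 1) * (2 * x - 1) / 6) in
  \sum_(a <= k < b) (s + k%:R * t) * (s' + k%:R * t') = Q b%:R - Q a%:R.
Proof.
move=> ab Q; rewrite -(@telescope_sumr _ a b (fun k => Q k%:R)) //.
apply: eq_bigr => k _; rewrite /Q -[k.+1%:R]natr1.
by field.
Qed.

(** The unit step at rank [a] minus the ramp [k / N]: evaluated at ranks, the
    contribution of one observation to the difference between the empirical
    cdf of its sample and the pooled one. *)
Definition step_ramp (F : numFieldType) (N a k : nat) : F :=
  (a <= k)%N%:R - k%:R / N%:R.

Lemma mean_step_ramp {F : numFieldType} (N a : nat) : (0 < a <= N)%N ->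
  N%:R^-1 * (\sum_(1 <= k < N.+1) step_ramp F N a k)
  = (N%:R + 1 - 2 * a%:R) / (2 * N%:R).
Proof.
move=> /andP[a0 aN].
have N0 : N%:R != 0 :> F by rewrite pnatr_eq0; lia.
rewrite (@big_cat_nat _ _ _ a) //=; last by lia.
rewrite (eq_big_nat _ _
  (F2 := fun k => (0 + k%:R * (- N%:R^-1)) * (1 + k%:R * 0))); last first.
  move=> k /andP[_ ka]; rewrite /step_ramp (leqNgt a) ka /=; ring.
rewrite [X in _ + X](eq_big_nat _ _
  (F2 := fun k => (1 + k%:R * (- N%:R^-1)) * (1 + k%:R * 0))); last first.
  move=> k /andP[ak _]; rewrite /step_ramp ak /=; ring.
rewrite !sum_quadratic //; last by lia.
rewrite -[N.+1%:R]natr1; field; exact: N0.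
Qed.

(** Shifting both ranks cyclically preserves the covariance, so it can only
    depend on [d]. The computation splits the sum at [a] and [b]; on
    each of the three pieces the summand is a quadratic polynomial in [k]. *)
Lemma cov_step_ramp {F : numFieldType} (N a b : nat) :
  (0 < a <= N)%N -> (0 < b <= N)%N ->
  let mean c : F := (N%:R + 1 - 2 * c%:R) / (2 * N%:R) in
  let d := `|a%:R - b%:R| / N%:R in
  N%:R^-1 * (\sum_(1 <= k < N.+1)
    (step_ramp F N a k - mean a) * (step_ramp F N b k - mean b))
  = 12^-1 - d * (1 - d) / 2 - (12 * N%:R ^+ 2)^-1.
Proof.
wlog ab : a b / (a <= b)%N.
  move=> H aN bN mean d; case/orP: (leq_total a b) => ab; first exact: H.
  rewrite /d distrC -H //; congr (_ * _); apply: eq_bigr => k _; exact: mulrC.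
move=> /andP[a0 aN] /andP[b0 bN] mean d.
have N0 : N%:R != 0 :> F by rewrite pnatr_eq0; lia.
have -> : d = (b%:R - a%:R) / N%:R.
  by rewrite /d distrC ger0_norm // subr_ge0 ler_nat.
(* The means are kept abstract until the sums have been evaluated. *)
have := erefl (mean a); have := erefl (mean b).
move: {2}(mean a) {2}(mean b) => ma mb mbE maE; rewrite maE mbE.
(* [s] and [s'] are the values of the two steps on a piece. *)
pose g (s s' : F) k :=
  (s - ma + k%:R * - N%:R^-1) * (s' - mb + k%:R * - N%:R^-1).
have gE s s' k : g s s' k = (s - k%:R / N%:R - ma) * (s' - k%:R / N%:R - mb).
  by rewrite /g mulrN [s - ma - _]addrAC [s' - mb - _]addrAC.
rewrite (@big_cat_nat _ _ _ a) //=; last by lia.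
rewrite [X in _ + X](@big_cat_nat _ _ _ b) //=; last by lia.
rewrite (eq_big_nat _ _ (F2 := g 0 0)); last first.
  by move=> k /andP[_ ka]; rewrite gE /step_ramp (leqNgt a) (leqNgt b)
    ka (leq_trans ka ab).
rewrite [X in _ + (X + _)](eq_big_nat _ _ (F2 := g 1 0)); last first.
  by move=> k /andP[ak kb]; rewrite gE /step_ramp ak (leqNgt b) kb.
rewrite [X in _ + (_ + X)](eq_big_nat _ _ (F2 := g 1 1)); last first.
  by move=> k /andP[bk _]; rewrite gE /step_ramp bk (leq_trans ab bk).
rewrite !sum_quadratic //; last by lia.
rewrite -maE -mbE /mean -[N.+1%:R]natr1.
move: N0; move: (N%:R) (a%:R) (b%:R) => n x y n0.
by field.
Qed.

(** The arccosine folds the angle [2 pi |d|] at [pi], that is [|d|] into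
    [1 - |d|] beyond one half, and the kernel is symmetric under that
    exchange. *)
Lemma watson_kernel_cos (R : realType) (d : R) : `|d| <= 1 ->
  watson_kernel (cos (2 * pi * d)) = 12^-1 - `|d| * (1 - `|d|) / 2.
Proof.
move=> d1; have p0 := pi_gt0 R; have pn := lt0r_neq0 p0.
have -> : cos (2 * pi * d) = cos (2 * pi * `|d|).
  by case: (ger0P d) => // _; rewrite mulrN cosN.
move: `|d| (normr_ge0 d) d1 => e e0 e1.
have [eh|eh] := leP e 2^-1.
  rewrite /watson_kernel cosK; last by rewrite in_itv /=; apply/andP; split; nra.
  by move: pi pn {p0} => p pn; field.
have -> : cos (2 * pi * e) = cos (2 * pi * (1 - e)).
  rewrite -[RHS]cosN -(cosD2pi (- _)); congr cos; rewrite mulr2n; ring.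
rewrite /watson_kernel cosK; last by rewrite in_itv /=; apply/andP; split; nra.
by move: pi pn {p0} => p pn; field.
Qed.

(** * Integration against the pooled empirical cdf *)

Definition pool {R : realType} {c : nat} {n : 'I_c -> nat}
    (theta : forall l, 'I_(n l) -> R) (p : {l : 'I_c & 'I_(n l)}) : R :=
  theta (tag p) (tagged p).

Section pooled.
Context {R : realType} {c : nat} {n : 'I_c -> nat}.
Variable theta : forall l, 'I_(n l) -> R.
Local Notation obs := {l : 'I_c & 'I_(n l)}.
Local Notation N := (total_size n).

Lemma card_obs : #|{: obs}| = N.
Proof.
rewrite card_tagged sumnE big_map big_enum.
by apply: eq_bigr => l _; rewrite card_ord.
Qed.

(** The weights [n_l / N] of the samples turn the within-sample averages into
    one average over the pooled sample. *)
Lemma pooled_ecdfE t :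
  pooled_ecdf theta t = N%:R^-1 * \sum_(p : obs) (pool theta p <= t)%R%:R.
Proof.
rewrite -(sig_big_dep xpredT (fun=> xpredT) (fun l i => (theta l i <= t)%R%:R)).
rewrite mulr_sumr; apply: eq_bigr => l _.
have -> : \sum_(i < n l) (theta l i <= t)%R%:R =
    #|[pred i | theta l i <= t]|%:R :> R.
  rewrite -natr_sum; congr _%:R; rewrite -sum1_card [RHS]big_mkcond /=.
  by apply: eq_bigr => i _; rewrite inE; case: (_ <= _)%R.
rewrite /ecdf [X in X * _]mulrC -mulrA; congr (_ * _); rewrite mulrC.
have [n0|n0] := eqVneq (n l) 0%N; last by rewrite divfK // pnatr_eq0.
suff -> : #|[pred i | theta l i <= t]| = 0%N by rewrite !mul0r.
by apply/eqP; rewrite -leqn0 -n0 -[leqRHS]card_ord max_card.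
Qed.

(** Sums of measures are indexed by natural numbers, so the pooled sample is
    enumerated as a sequence, on which Dirac masses are placed. *)
Let pts := [seq pool theta p | p <- enum {: obs}].
Let pooled_dirac (k : nat) : {measure set (measurableTypeR R) -> \bar R} :=
  dirac (nth 0 pts k : measurableTypeR R).
Let pooled_mean_measure : {measure set (measurableTypeR R) -> \bar R} :=
  mscale ((N%:R^-1 : R)%:nng) (msum pooled_dirac (size pts)).

Let sum_pts (V : nmodType) (F : R -> V) :
  \sum_(k < size pts) F (nth 0 pts k) = \sum_(p : obs) F (pool theta p).
Proof.
rewrite -(big_mkord xpredT (fun k => F (nth 0 pts k))).
by rewrite -(big_nth 0 xpredT) /= big_map big_enum.
Qed.

(** A Stieltjes measure is determined by its values on the intervals
    [`]a, b]], where this is the increment of [pooled_ecdfE]. *)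
Let pooled_measureE A : measurable A ->
  lebesgue_stieltjes_measure (pooled_ecdf theta) A = pooled_mean_measure A.
Proof.
apply: lebesgue_stieltjes_measure_unique => X oX.
rewrite /lebesgue_stieltjes_measure /= /measure_extension measurable_mu_extE //=.
rewrite /mscale /= /msum /=.
under eq_bigr do rewrite diracE.
rewrite (sum_pts _ (fun x => (x \in X)%:R%:E)).
case: oX => -[a b] _ <- /=.
have [ab|ba] := leP a b; last first.
  rewrite set_itv_ge ?bnd_simp -?leNgt ?ltW // wlength0 big1 ?mule0 // => p _.
  by rewrite in_set0.
rewrite wlength_itv_bnd // !pooled_ecdfE -?EFinD -mulrBr -sumrB sumEFin -EFinM.
congr (_ * _)%:E; apply: eq_bigr => p _.
rewrite mem_setE in_itv /=.
have [xa|ax] := leP (pool theta p) a; last by rewrite subr0.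
by rewrite (le_trans xa ab) subrr.
Qed.

Let ge0_integral_pooled (f : R -> \bar R) :
  (forall p, 0 <= pool theta p < 2 * pi) ->
  measurable_fun [set: R] f -> (forall x, (0 <= f x)%E) ->
  (\int[lebesgue_stieltjes_measure (pooled_ecdf theta)]_(x in
     `[0%R, (2 * pi)%R[) f x)%E
  = ((N%:R^-1)%:E * \sum_(p : obs) f (pool theta p))%E.
Proof.
move=> xr mf f0.
rewrite (eq_measure_integral pooled_mean_measure); last first.
  by move=> A mA _; exact: pooled_measureE.
have mD : measurable (`[0, 2 * pi[ : set (measurableTypeR R)).
  exact: measurable_itv.
have mfD : measurable_fun (`[0, 2 * pi[ : set (measurableTypeR R)) f.
  exact: measurable_funS mf.
rewrite ge0_integral_mscale // ge0_integral_measure_sum //; congr (_ * _)%E.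
under eq_bigr do rewrite integral_dirac // diracE.
rewrite (sum_pts _
  (fun x => ((x \in `[0%R, (2 * pi)%R[%classic)%:R%:E * f x)%E)).
by apply: eq_bigr => p _; rewrite mem_setE in_itv /= xr mul1e.
Qed.

(** The positive and negative parts are integrated separately; each
    of the two integrals is a finite sum of reals. *)
Lemma pooled_integralE (f : R -> R) :
  (forall p, 0 <= pool theta p < 2 * pi) -> measurable_fun setT f ->
  pooled_integral theta f = N%:R^-1 * \sum_(p : obs) f (pool theta p).
Proof.
move=> xr mf.
have mF : measurable_fun setT (EFin \o f) by exact/measurable_EFinP.
rewrite /pooled_integral /Rintegral integralE.
rewrite !ge0_integral_pooled //; last 2 first.
- exact: measurable_funeneg.
- exact: measurable_funepos.
under eq_bigr do rewrite funeposE -EFin_max.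
under [in X in (_ - X)%E]eq_bigr do rewrite funenegE -EFin_max.
rewrite !sumEFin -!EFinM -EFinB /= -mulrBr -sumrB; congr (_ * _).
apply: eq_bigr => p _.
by case: (lerP 0 (f (pool theta p))) => h; rewrite ?(max_l h) /Num.max;
  case: ltP; case: ltP; lra.
Qed.

End pooled.

(** * Absence of ties *)

(** The joint law of independent variables is the product of their laws, and
    by Fubini the mass of the diagonal is the integral of the atoms of [Y]. *)
Lemma independent_nonatomic_neq (R : realType) (d : measure_display)
    (Omega : measurableType d) (P : probability Omega R) (X Y : {RV P >-> R}) :
  (forall A B : set R, measurable A -> measurable B ->
     P (X @^-1` A `&` Y @^-1` B) = (P (X @^-1` A) * P (Y @^-1` B))%E) ->
  (forall y, P (Y @^-1` [set y]) = 0%E) ->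
  {ae P, forall w, X w != Y w}.
Proof.
move=> XY Y0.
have mXY : measurable_fun setT (fun w => (X w, Y w)).
  by apply: measurable_fun_pair; exact: measurable_funPT.
pose XYf : {mfun Omega >-> (R * R)%type} := mfun_Sub (mem_set mXY).
pose D := [set p : R * R | p.1 == p.2].
have mD : measurable D.
  have := @measurable_fun_eqr _ _ R setT fst snd measurable_fst measurable_snd.
  by move=> /(_ measurableT [set true] I); rewrite setTI.
have jointE := @product_measure_unique _ _ _ _ _ (distribution P X)
  (distribution P Y) (distribution P XYf).
exists (XYf @^-1` D); split.
- exact: measurable_funPTI.
- rewrite -[LHS]/(distribution P XYf D) -jointE //.
  rewrite /product_measure1 integral0_eq // => x _ /=.
  rewrite -[RHS](Y0 x) /distribution /pushforward; congr (P _).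
  by apply/seteqP; split=> w; rewrite /xsection /= in_setE /D /=;
    [move/eqP | move=> ->].
- by move=> w /= /negP; rewrite negbK.
Qed.

Lemma ae_no_ties (R : realType) (d : measure_display)
    (Omega : measurableType d) (P : probability Omega R) (I : finType)
    (X : I -> {RV P >-> R}) : mutually_independent X ->
  (forall i, distribution P (X i) `<< lebesgue_measure) ->
  {ae P, forall w, injective (X ^~ w)}.
Proof.
move=> indX acX.
suff : {ae P, forall w, forall p q, p != q -> X p w != X q w}.
  apply: filterS => w H p q /eqP; apply: contraTeq; exact: H.
apply: filter_forall => p; apply: filter_forall => q.
have [->|pq] := eqVneq p q; first exact: aeW.
have : {ae P, forall w, X p w != X q w}; last by apply: filterS.
apply: independent_nonatomic_neq => [A B mA mB|y].
  (* Mutual independence is used for the two-element subfamily [p, q]. *)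
  pose E i := if i == p then A else B.
  have mE i : measurable (E i) by rewrite /E; case: ifP.
  have := indX [set p; q]%SET E mE.
  rewrite big_setU1 ?inE //= big_set1 /E eqxx eq_sym (negbTE pq) => <-.
  congr (P _); apply/seteqP; split => w /=.
    move=> [Aw Bw] i /=; rewrite !inE => /orP[] /eqP ->; first by rewrite eqxx.
    by rewrite eq_sym (negbTE pq).
  move=> H; split.
    by have := H p; rewrite eqxx; apply; rewrite /= !inE eqxx.
  by have := H q; rewrite eq_sym (negbTE pq); apply; rewrite /= !inE eqxx orbT.
have null_y : lebesgue_measure.-null_set [set y].
  move=> A mA Ay; apply/eqP; rewrite eq_le measure_ge0 andbT.
  by rewrite -(lebesgue_measure_set1 y) le_measure ?inE.
exact: (acX q _ null_y) (measurable_set1 y) _.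
Qed.

(** * Ranks and the identity for samples without ties *)

Section ranks.
Context {R : realType} {c : nat} {n : 'I_c -> nat}.
Variable theta : forall l, 'I_(n l) -> R.
Local Notation obs := {l : 'I_c & 'I_(n l)}.
Local Notation N := (total_size n).
Local Notation obs_of i := (Tagged (fun l => 'I_(n l)) i).
Local Notation rank p := (pooled_rank theta (tagged p)).

(** Ranks reproduce the order of the angles, ties included, since the rank of an
    observation counts the pooled angles up to it. *)
Lemma leq_pooled_rank (p q : obs) :
  (rank p <= rank q)%N = (pool theta p <= pool theta q).
Proof.
have [pq|qp] := leP (pool theta p) (pool theta q).
  apply/subset_leq_card/fintype.subsetP => s; rewrite !inE => /le_trans; exact.
apply/negbTE; rewrite -ltnNge; apply/proper_card/fintype.properP; split.
  apply/fintype.subsetP => s; rewrite !inE => sq; exact: le_trans (ltW qp).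
by exists p; rewrite !inE ?lexx // -ltNge.
Qed.

Lemma pooled_rank_bounds (p : obs) : (0 < rank p <= N)%N.
Proof.
apply/andP; split; last by rewrite -card_obs max_card.
by apply/card_gt0P; exists p; rewrite inE.
Qed.

(** Without ties the ranks are pairwise distinct, and there are [N] of them in
    [1, ..., N], so they exhaust it. *)
Lemma sum_over_ranks (V : nmodType) (F : nat -> V) : injective (pool theta) ->
  \sum_(p : obs) F (rank p) = \sum_(1 <= k < N.+1) F k.
Proof.
move=> inj; rewrite -big_enum -(big_map (fun p => rank p) xpredT F) /=.
apply: perm_big; set s := map _ _.
have us : uniq s.
  rewrite map_inj_uniq ?enum_uniq // => p q /eqP.
  by rewrite eqn_leq !leq_pooled_rank -eq_le => /eqP /inj.
have sub : {subset s <= index_iota 1 N.+1}.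
  by move=> k /mapP[p _ ->]; rewrite mem_index_iota ltnS pooled_rank_bounds.
have [|_ ss] := uniq_min_size us sub.
  by rewrite size_map -cardE card_obs size_iota subn1.
by apply: uniq_perm => //; exact: iota_uniq.
Qed.

Lemma pooled_ecdf_rank (p : obs) :
  pooled_ecdf theta (pool theta p) = (rank p)%:R / N%:R.
Proof.
rewrite pooled_ecdfE mulrC -natr_sum /pooled_rank -sum1_card [in RHS]big_mkcond.
by congr (_%:R / _); apply: eq_bigr => q _; rewrite inE; case: (_ <= _)%R.
Qed.

Lemma ecdf_subr_pooled_rank (l : 'I_c) (p : obs) : (0 < n l)%N ->
  ecdf (theta l) (pool theta p) - pooled_ecdf theta (pool theta p)
  = (n l)%:R^-1 * \sum_(i < n l) step_ramp R N (pooled_rank theta i) (rank p).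
Proof.
move=> n0; rewrite pooled_ecdf_rank sumrB mulrBr; congr (_ - _); last first.
  rewrite sumr_const card_ord -[(_ / _) *+ _]mulr_natl mulKf //.
  by rewrite pnatr_eq0 -lt0n.
rewrite /ecdf mulrC -natr_sum -sum1_card [in LHS]big_mkcond /=.
congr (_ * _%:R); apply: eq_bigr => i _.
rewrite inE (leq_pooled_rank (obs_of i)) /pool /=.
by case: (_ <= _)%R.
Qed.

Lemma watson_kernel_score (l : 'I_c) (i j : 'I_(n l)) :
  let d : R := `|(pooled_rank theta i)%:R - (pooled_rank theta j)%:R| / N%:R in
  watson_kernel (cos (uniform_score theta i - uniform_score theta j))
  = 12^-1 - d * (1 - d) / 2.
Proof.
move=> d.
have /andP[i0 iN] := pooled_rank_bounds (obs_of i).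
have /andP[j0 jN] := pooled_rank_bounds (obs_of j).
have N0 : 0 < N%:R :> R by rewrite ltr0n (leq_trans i0).
pose e : R := ((pooled_rank theta i)%:R - (pooled_rank theta j)%:R) / N%:R.
have de : d = `|e| by rewrite normrM normfV [`|N%:R|]gtr0_norm.
have d1 : `|e| <= 1.
  rewrite -de ler_pdivrMr // mul1r ler_norml -!(ler_nat R) in iN jN *.
  have := ler0n R (pooled_rank theta i); have := ler0n R (pooled_rank theta j).
  by move: iN jN => /= *; apply/andP; split; lra.
rewrite de -watson_kernel_cos //; congr (watson_kernel (cos _)).
by rewrite /uniform_score -mulrBl -mulrBr -mulrA.
Qed.

(** The square of the average over sample [l] is expanded into a double sum over
    its members, and the average over the pooled sample is moved inside,
    where it becomes a covariance of steps. *)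
Lemma watson_U2_no_ties : (forall l, 0 < n l)%N -> injective (pool theta) ->
  (forall p, 0 <= pool theta p < 2 * pi) ->
  watson_U2 theta = watson_T theta - (12 * N%:R)^-1.
Proof.
move=> n_gt0 inj range.
have n0 l : (n l)%:R != 0 :> R by rewrite pnatr_eq0 -lt0n.
have mD l :
    measurable_fun setT (fun x => ecdf (theta l) x - pooled_ecdf theta x).
  apply: measurable_funB; apply: nondecreasing_measurable => //.
    exact: ecdf_nondecreasing.
  exact: pooled_ecdf_nondecreasing.
pose m a : R := (N%:R + 1 - 2 * a%:R) / (2 * N%:R).
have -> : (12 * N%:R)^-1 =
    \sum_(l < c) (n l)%:R^-1 *
      \sum_(i < n l) \sum_(j < n l) (12 * N%:R ^+ 2)^-1 :> R.
  under eq_bigr => l _ do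
    rewrite !sumr_const !card_ord -[_^-1 *+ _ *+ _]mulr_natl mulKf //
      -[_^-1 *+ _]mulr_natl.
  rewrite -mulr_suml -natr_sum -/N.
  (* For [N = 0] both sides vanish, the inverse of 0 being 0. *)
  have [->|N0] := eqVneq N%:R (0 : R); first by rewrite mulr0 mul0r invr0.
  by field.
rewrite /watson_T -sumrB; apply: eq_bigr => l _.
rewrite -mulrBr -sumrB.
under [in RHS]eq_bigr do rewrite -sumrB.
have -> : pooled_integral theta
      (fun y => ecdf (theta l) y - pooled_ecdf theta y)
    = (n l)%:R^-1 * \sum_(i < n l) m (pooled_rank theta i).
  rewrite pooled_integralE //.
  under eq_bigr do rewrite ecdf_subr_pooled_rank //.
  rewrite -mulr_sumr mulrCA exchange_big mulr_sumr; congr (_ * _).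
  apply: eq_bigr => i _; rewrite sum_over_ranks // mean_step_ramp //.
  exact: (pooled_rank_bounds (obs_of i)).
rewrite pooled_integralE //; last first.
  by apply: measurable_funX; apply: measurable_funB => //; exact: measurable_cst.
pose g (i : 'I_(n l)) k :=
  step_ramp R N (pooled_rank theta i) k - m (pooled_rank theta i).
under [in LHS]eq_bigr => p _ do
  rewrite ecdf_subr_pooled_rank // -mulrBr -sumrB exprMn [X in _ * X]expr2
    mulr_suml.
rewrite (sum_over_ranks _
  (fun k => (n l)%:R^-1 ^+ 2 * \sum_i g i k * \sum_j g j k)) //.
rewrite -mulr_sumr [N%:R^-1 * _]mulrCA [LHS]mulrA.
congr (_ * _); first by field.
rewrite exchange_big mulr_sumr; apply: eq_bigr => i _.
under eq_bigr do rewrite mulr_sumr.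
rewrite exchange_big mulr_sumr; apply: eq_bigr => j _.
rewrite cov_step_ramp; last 2 first.
- exact: (pooled_rank_bounds (obs_of i)).
- exact: (pooled_rank_bounds (obs_of j)).
by rewrite watson_kernel_score.
Qed.
End ranks.

Theorem proposition3p1 (R : realType) (d : measure_display)
    (Omega : measurableType d) (P : probability Omega R)
    (c : nat) (n : 'I_c -> nat)
    (Theta : forall l : 'I_c, 'I_(n l) -> {RV P >-> R})
    (c_ge2 : (2 <= c)%N)
    (n_ge2 : forall l : 'I_c, (2 <= n l)%N)
    (Theta_range : forall (l : 'I_c) (i : 'I_(n l)) (w : Omega),
      0 <= Theta l i w < 2 * pi)
    (Theta_indep : mutually_independent
      (fun p : {l : 'I_c & 'I_(n l)} => Theta (tag p) (tagged p)))
    (Theta_ac : forall (l : 'I_c) (i : 'I_(n l)),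
      distribution P (Theta l i) `<< lebesgue_measure) :
  {ae P, forall w : Omega,
    watson_U2 (fun l i => Theta l i w) =
    watson_T (fun l i => Theta l i w) - (12 * (total_size n)%:R)^-1}.
Proof.
have no_ties := @ae_no_ties R d Omega P {l : 'I_c & 'I_(n l)}
  (fun p => Theta (tag p) (tagged p)) Theta_indep
  (fun p => Theta_ac (tag p) (tagged p)).
apply: filterS no_ties => w inj; apply: watson_U2_no_ties => //.
- by move=> l; exact: ltnW (n_ge2 l).
- by move=> p; exact: Theta_range.
Qed.
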